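(* Let $\lambda, x\ge 0$ be real. Then the function $\nu\mapsto E_\nu(\lambda,x)$ is log-convex on $(0,\infty)$, i.e. for all $\nu_1>0$, $\nu_2>0$ and all $\alpha\in[0,1]$, $$E_{\alpha\nu_1+(1-\alpha)\nu_2}(\lambda,x)\le \left[E_{\nu_1}(\lambda,x)\right]^{\alpha}\left[E_{\nu_2}(\lambda,x)\right]^{1-\alpha}.$$ In particular, for all $\nu>0$, $$\left[E_{\nu+1}(\lambda,x)\right]^2\le E_\nu(\lambda,x)\,E_{\nu+2}(\lambda,x).$$
   Context: For $\nu>0$ and $\lambda,x\in\mathbb{R}$, the Dunkl kernel is $$E_\nu(\lambda,x)=j_{\nu-\frac12}(i\lambda x)+\frac{\lambda x}{2\nu+1}\,j_{\nu+\frac12}(i\lambda x),$$ where $j_\alpha$ is the normalized Bessel function of the first kind of order $\alpha$, $$j_\alpha(z)=\Gamma(\alpha+1)\sum_{n=0}^\infty\frac{(-1)^n (z/2)^{2n}}{n!\,\Gamma(n+\alpha+1)}.$$ In particular $j_\alpha(i\lambda x)=\Gamma(\alpha+1)\sum_{n\ge0}\frac{(\lambda x/2)^{2n}}{n!\,\Gamma(n+\alpha+1)}$ is real. *)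

(* Defs.v *)
From HB Require Import structures.
From mathcomp Require Import all_boot all_order all_algebra complex.
From mathcomp Require Import all_classical all_reals all_analysis.

Set Implicit Arguments.
Unset Strict Implicit.
Unset Printing Implicit Defensive.

Import Order.TTheory GRing.Theory Num.Theory.
Import numFieldNormedType.Exports.

Local Open Scope classical_set_scope.
Local Open Scope ring_scope.
Local Open Scope complex_scope.

(* Euler's integral: the Gamma function on s > 0 only (no analytic
   continuation). *)
Definition Gamma (R : realType) (s : R) : R :=
  \int[lebesgue_measure]_(t in `]0, +oo[) (t `^ (s - 1) * expR (- t)).

(* The alias [R[i]^o] gives access to the norm topology of [R[i]]. *)
Definition besselj_coeff (R : realType) (a : R) (z : R[i]) (n : nat) : R[i]^o :=
  (-1) ^+ n * (z / 2) ^+ (2 * n) / (n`!%:R * (Gamma (n%:R + a + 1))%:C).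

(* [Gamma] limits this to orders a > -1; the Dunkl kernel of parameter
   nu > 0 only uses a = nu - 1/2 and a = nu + 1/2. *)
Definition besselj (R : realType) (a : R) (z : R[i]) : R[i] :=
  (Gamma (a + 1))%:C * limn (series (besselj_coeff a z)).

Definition dunkl_kernelC (R : realType) (nu lambda x : R) : R[i] :=
  besselj (nu - 2^-1) ('i%C * (lambda * x)%:C)
  + (lambda * x / (2 * nu + 1))%:C *
    besselj (nu + 2^-1) ('i%C * (lambda * x)%:C).

(* No information is lost in taking the real part: see [dunkl_kernelE]. *)
Definition dunkl_kernel (R : realType) (nu lambda x : R) : R :=
  complex.Re (dunkl_kernelC nu lambda x).

Lemma limn_real_complex (R : realType) (u : nat -> R) :
  limn (fun n => (u n)%:C : R[i]^o) = (limn u)%:C.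
Proof.
have H (l : R[i]^o) : ((fun n => (u n)%:C : R[i]^o) @ \oo --> l) ->
    u @ \oo --> complex.Re l.
  move=> /cvgrPdist_lt ul; apply/cvgrPdist_lt => e e0.
  have /ul : 0 < e%:C :> R[i] by rewrite ltcR.
  apply: filterS => n; rewrite normc_def ltcR => h.
  apply: le_lt_trans h.
  case: l {ul} => a b /=; rewrite -[leLHS]sqrtr_sqr ler_wsqrtr//.
  by rewrite lerDl sqr_ge0.
have [cu|ncu] := pselect (cvgn u).
  apply/cvg_lim => //; apply/cvgrPdist_lt => e.
  have := cu => /cvgrPdist_lt cu' e0.
  have /complex_realP [k ek] : e \is Num.real by exact: gtr0_real.
  move: e0; rewrite ek ltcR => /cu'.
  apply: filterS => n.
  by rewrite -rmorphB normc_def ltcR /= expr0n addr0 sqrtr_sqr.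
have ncu' : ~ cvgn (fun n => (u n)%:C : R[i]^o).
  by move=> /cvg_ex [l /H h]; apply: ncu; apply/cvg_ex; exists (complex.Re l).
transitivity (0 : R[i]^o); first exact: (dvgP ncu').
by rewrite [X in X%:C](_ : _ = 0) ?rmorph0//; exact: (dvgP ncu).
Qed.

Lemma besselj_imag (R : realType) (a t : R) :
  besselj a ('i%C * t%:C) =
  (Gamma (a + 1) * limn (series (fun n =>
     (t / 2) ^+ (2 * n) / (n`!%:R * Gamma (n%:R + a + 1)))))%:C.
Proof.
rewrite /besselj [RHS]rmorphM; congr GRing.mul.
apply: (etrans _ (limn_real_complex _)); apply: (congr1 (fun u => limn u)).
apply/funext => N; rewrite !seriesEnat [RHS]rmorph_sum; apply: eq_bigr => n _.
rewrite /besselj_coeff [RHS]fmorph_div rmorphM rmorph_nat; congr (_ / _).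
rewrite rmorphXn fmorph_div rmorph_nat -[_ / 2 in LHS]mulrA exprMn.
by rewrite (exprM 'i%C) sqr_i mulrA -exprMn mulrNN mulr1 expr1n mul1r.
Qed.

Lemma dunkl_kernelE (R : realType) (nu lambda x : R) :
  (dunkl_kernel nu lambda x)%:C = dunkl_kernelC nu lambda x.
Proof.
by rewrite /dunkl_kernel /dunkl_kernelC !besselj_imag -rmorphM -rmorphD.
Qed.

(* Main.v *)
(** Since [Gamma (a + 1) = a * Gamma a], the two Bessel series of the Dunkl
    kernel merge, with [a = nu + 1/2] and [t = lambda * x], into
    [\sum_n (t/2)^(2n) / n! * (p_n(a) + t/2 * p_(n+1)(a))], where
    [p_n(a) = 1 / (a (a+1) ... (a+n-1))]. Each [1 / (a + k)] is log-convex in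
    [a] by weighted AM-GM, products of log-convex functions are log-convex, and
    by Hoelder's inequality so are their sums and pointwise limits. The second
    inequality is log-convexity at the midpoint of [nu] and [nu + 2]. *)

Require Import Defs.
From mathcomp Require Import all_boot all_order all_algebra complex.
From mathcomp Require Import all_classical all_reals all_analysis.
From mathcomp Require Import measurable_realfun ring lra.

Set Implicit Arguments.
Unset Strict Implicit.
Unset Printing Implicit Defensive.

Import Order.TTheory GRing.Theory Num.Theory.
Import numFieldNormedType.Exports.

Local Open Scope classical_set_scope.
Local Open Scope ring_scope.

(** * The Gamma function on the positive reals *)

Section Gamma.
Context {R : realType}.
Notation mu := (@lebesgue_measure R).
Implicit Types (s t a b : R).

Definition gamma_integrand s t : R := t `^ (s - 1) * expR (- t).

(* Extended-real valued, so that the functional equation can be proved before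
   the convergence of the integral. *)
Definition eGamma s : \bar R :=
  (\int[mu]_(t in `]0%R, +oo[) (gamma_integrand s t)%:E)%E.

Lemma gamma_integrand_ge0 s t : 0 <= gamma_integrand s t.
Proof. by rewrite mulr_ge0 ?powR_ge0 ?expR_ge0. Qed.

Lemma measurable_gamma_integrand (A : set R) s :
  measurable_fun A (gamma_integrand s).
Proof.
apply: measurable_funTS; apply: measurable_funM.
  exact: measurable_powR.
by apply: measurableT_comp => //; exact: measurable_expR.
Qed.

Lemma continuous_expRN : continuous (fun t : R => expR (- t)).
Proof.
move=> t; apply: continuous_comp; last exact: continuous_expR.
by apply: (@continuousN _ R^o); exact: cvg_id.
Qed.

Lemma continuous_powR s t : 0 < t -> {for t, continuous (fun u : R => u `^ s)}.
Proof.
move=> t0; apply: differentiable_continuous; apply/derivable1_diffP.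
by apply: derivable_powR; rewrite in_itv/= andbT.
Qed.

Lemma derivable_oo_LRcontinuous_powR s a b : 0 < a -> a < b ->
  derivable_oo_LRcontinuous (fun t : R => t `^ s) a b.
Proof.
move=> a0 ab; split=> [t| |].
- rewrite in_itv/= => /andP[ta _].
  by apply: derivable_powR; rewrite in_itv/= andbT (lt_trans a0).
- exact/cvg_at_right_filter/continuous_powR.
- exact/cvg_at_left_filter/continuous_powR/(lt_trans a0).
Qed.

Lemma derivable_oo_LRcontinuous_NexpRN a b :
  derivable_oo_LRcontinuous (fun t : R => - expR (- t)) a b.
Proof.
split.
- by move=> t _; exact: ex_derive.
- by apply/cvg_at_right_filter; apply: cvgN; exact: continuous_expRN.
- by apply/cvg_at_left_filter; apply: cvgN; exact: continuous_expRN.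
Qed.

(** Integration by parts with [t^s] and the antiderivative [- expR (- t)]. Keeping [0 < a] avoids
    the singularity of [t^(s - 1)] at 0 when [s < 1]. *)
Lemma gamma_integrand_parts s a b : 0 < s -> 0 < a -> a < b ->
  (\int[mu]_(t in `[a, b]) (gamma_integrand (s + 1) t)%:E =
   s%:E * (\int[mu]_(t in `[a, b]) (gamma_integrand s t)%:E) +
   (a `^ s * expR (- a) - b `^ s * expR (- b))%:E)%E.
Proof.
move=> s0 a0 ab.
under eq_integral do rewrite /gamma_integrand addrK.
rewrite (@integration_by_parts R (fun t => t `^ s) (fun t => - expR (- t))
  (fun t => s * t `^ (s - 1)) (fun t => expR (- t)) a b)//.
- rewrite addeC; congr (_ + _)%E; last by congr EFin; ring.
  rewrite -ge0_integralZl//=.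
  + under eq_integral do rewrite mulrN EFinN.
    rewrite integral_ge0N ?oppeK; last first.
      by move=> t _; rewrite lee_fin !mulr_ge0 ?powR_ge0 ?expR_ge0 ?(ltW s0).
    by apply: eq_integral => t _; rewrite -EFinM mulrA.
  + by apply/measurable_EFinP; exact: measurable_gamma_integrand.
  + by move=> t _; rewrite lee_fin gamma_integrand_ge0.
  + by rewrite lee_fin ltW.
- apply: continuous_in_subspaceT => t; rewrite inE/= in_itv/= => /andP[ta _].
  apply: cvgM; first exact: cvg_cst.
  exact/continuous_powR/(lt_le_trans a0).
- exact: derivable_oo_LRcontinuous_powR.
- move=> t; rewrite in_itv/= => /andP[ta _].
  by apply: powR_derive1; rewrite in_itv/= andbT (lt_trans a0).
- by apply: continuous_subspaceT; exact: continuous_expRN.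
- exact: derivable_oo_LRcontinuous_NexpRN.
- move=> t _; rewrite derive1E derive_val.
  by rewrite mulrN1 opprK.
Qed.

Lemma cvg_powR_expRN_0 s :
  0 < s -> t `^ s * expR (- t) @[t --> (0 : R)^'+] --> (0 : R).
Proof.
move=> s0; rewrite -[X in _ --> X](mul0r (expR (- 0))).
apply: cvgM; first exact: powR_cvg0.
by apply: cvg_at_right_filter; exact: continuous_expRN.
Qed.

(** Squeeze: for a natural number [m > s], [n^s <= n^m] and [expR n >= n^(m+1) / (m+1)!], so the
    terms are at most a constant times [harmonic n]. *)
Lemma cvg_powR_expRN_y s :
  n.+1%:R `^ s * expR (- n.+1%:R) @[n --> \oo] --> (0 : R).
Proof.
pose m := (Num.truncn s).+1; pose c : R := m.+1`!%:R.
have lim0 : c * harmonic n @[n --> \oo] --> (0 : R).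
  rewrite -[X in _ --> X](mulr0 c).
  by apply: cvgM; [exact: cvg_cst|exact: cvg_harmonic].
apply: (squeeze_cvgr _ (cvg_cst 0) lim0); near=> n.
rewrite mulr_ge0 ?powR_ge0 ?expR_ge0//=.
have n0 : 0 < n.+1%:R :> R by rewrite ltr0n.
have sm : n.+1%:R `^ s <= n.+1%:R ^+ m :> R.
  rewrite -powR_mulrn ?(ltW n0)// ler_powR ?ler1n//.
  by rewrite ltW// /m truncnS_gt.
rewrite expRN ler_pdivrMr ?expR_gt0// (le_trans sm)//.
have := expR_ge1Dxn m (ltW n0); rewrite -/c => le_e.
have c0 : 0 < c by rewrite ltr0n fact_gt0.
rewrite /harmonic/= mulrAC ler_pdivlMr// -exprSr mulrC -ler_pdivrMr//.
by apply: le_trans le_e; rewrite lerDr.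
Unshelve. all: by end_near. Qed.

(** The upper end is [n.+2] rather than [n.+1], so that the segment is nondegenerate already at
    [n = 0], as integration by parts requires. *)
Definition gamma_segment n : set R := `[n.+1%:R^-1, n.+2%:R].

Lemma bigcup_gamma_segment : \bigcup_n gamma_segment n = `]0, +oo[%classic.
Proof.
apply/seteqP; split=> t.
  move=> [n _]; rewrite /gamma_segment/= !in_itv/= andbT => /andP[+ _].
  by apply: lt_le_trans; rewrite invr_gt0.
rewrite /= in_itv/= andbT => t0.
pose n := maxn (Num.truncn t) (Num.truncn t^-1); exists n => //.
rewrite /gamma_segment/= in_itv/= invf_ple ?posrE//; apply/andP; split.
  by apply/ltW/(lt_le_trans (truncnS_gt _)); rewrite ler_nat ltnS leq_maxr.
by apply/ltW/(lt_le_trans (truncnS_gt _)); rewrite ler_nat ltnS leqW ?leq_maxl.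
Qed.

(** Monotone convergence: the integrand is nonnegative and the segments increase to the
    half-line. *)
Lemma gamma_segment_cvg s :
  (\int[mu]_(t in gamma_segment n) (gamma_integrand s t)%:E @[n --> \oo]
    --> eGamma s)%E.
Proof.
rewrite /eGamma -bigcup_gamma_segment.
apply: ge0_nondecreasing_set_cvg_integral.
- apply/nondecreasing_seqP => n; rewrite subsetEset; apply: subset_itv.
    by rewrite bnd_simp lef_pV2 ?posrE// ler_nat.
  by rewrite bnd_simp ler_nat.
- by move=> n; exact: measurable_itv.
- by move=> n; apply/measurable_EFinP; exact: measurable_gamma_integrand.
- by move=> n t _; rewrite lee_fin gamma_integrand_ge0.
Qed.

(** Limit of the integration by parts along the segments; the boundary terms vanish at both ends. *)
Lemma eGammaS s : 0 < s -> eGamma (s + 1) = (s%:E * eGamma s)%E.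
Proof.
move=> s0; have := @gamma_segment_cvg (s + 1).
have lt_ends n : n.+1%:R^-1 < n.+2%:R :> R.
  by rewrite (@le_lt_trans _ _ 1) ?invf_le1 ?ler1n ?ltr1n.
under eq_fun do rewrite gamma_integrand_parts//.
move=> /cvg_lim <-//; apply/cvg_lim => //.
rewrite -[X in _ --> X]adde0; apply: cvgeD.
- exact: fin_num_adde_defl.
- by apply: cvgeZl => //; exact: gamma_segment_cvg.
- apply: cvg_EFin; first exact: nearW.
  rewrite -[X in _ --> X](subr0 0); apply: cvgB.
    have /cvg_at_rightP := cvg_powR_expRN_0 s0; apply; split => //.
    exact: cvg_harmonic.
  (* The upper ends are [n.+2], whence a shift by one. *)
  have := cvg_powR_expRN_y s; rewrite -cvg_shiftS; exact.
Qed.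

Lemma eGamma_ge0 s : (0 <= eGamma s)%E.
Proof. by apply: integral_ge0 => t _; rewrite lee_fin gamma_integrand_ge0. Qed.

(** On the positive reals the integrand is the density of the exponential law of rate 1, whose total
    mass is 1. *)
Lemma eGamma1_lty : (eGamma 1 < +oo)%E.
Proof.
apply: (@le_lt_trans _ _ 1%E); last exact: ltry.
rewrite -(@integral_exponential_pdf R 1)//.
apply: (@le_trans _ _
    (\int[mu]_(t in `]0%R, +oo[) (exponential_pdf 1 t)%:E)%E).
  apply: ge0_le_integral => //=.
  - by move=> t _; rewrite lee_fin gamma_integrand_ge0.
  - by apply/measurable_EFinP; exact: measurable_gamma_integrand.
  - apply/measurable_EFinP; apply: measurable_funTS.
    exact: measurable_exponential_pdf.
  - move=> t; rewrite in_itv/= andbT => t0.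
    rewrite exponential_pdfE ?(ltW t0)//.
    by rewrite /gamma_integrand subrr powRr0 !mul1r mulN1r.
apply: ge0_subset_integral => //=.
  by apply/measurable_EFinP; exact: measurable_exponential_pdf.
by move=> t _; rewrite lee_fin exponential_pdf_ge0.
Qed.

Lemma eGamma_nat_lty m : (eGamma m.+1%:R < +oo)%E.
Proof.
elim: m => [|m IH]; first exact: eGamma1_lty.
by rewrite -natr1 eGammaS// lte_mul_pinfty ?lee_fin.
Qed.

(* [t^s <= 1 + t^m] for a natural number [m >= s] bounds
   [eGamma (s + 1) = s * eGamma s]. *)
Lemma eGamma_lty s : 0 < s -> (eGamma s < +oo)%E.
Proof.
move=> s0; pose m := (Num.truncn s).+1.
have : (s%:E * eGamma s < +oo)%E.
  rewrite -eGammaS//.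
  apply: (@le_lt_trans _ _ (eGamma 1 + eGamma m.+1%:R)%E); last first.
    by rewrite lte_add_pinfty ?eGamma1_lty ?eGamma_nat_lty.
  have mg r : measurable_fun (`]0, +oo[%classic : set R)
      (fun t : R => (gamma_integrand r t)%:E).
    by apply/measurable_EFinP; exact: measurable_gamma_integrand.
  have g0 r t : `]0, +oo[%classic t -> (0 <= (gamma_integrand r t)%:E)%E.
    by rewrite lee_fin gamma_integrand_ge0.
  rewrite /eGamma -ge0_integralD//.
  - apply: ge0_le_integral => //.
    + exact: g0.
    + exact: mg.
    + by apply: emeasurable_funD; exact: mg.
    + move=> t; rewrite /= in_itv/= andbT => t0.
      rewrite lee_fin /gamma_integrand subrr powRr0 addrK -natr1 addrK -mulrDl.
      rewrite ler_wpM2r ?expR_ge0//; have [t1|t1] := leP 1 t.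
        by rewrite ler_wpDl// ler_powR// ltW// truncnS_gt.
      rewrite ler_wpDr ?powR_ge0// -(powRr0 t).
      by rewrite ger_powR ?t0 ?(ltW t1) ?(ltW s0).
  - exact: g0.
  - exact: mg.
  - exact: g0.
  - exact: mg.
case: (eGamma s) => [r _||]//; first exact: ltry.
by rewrite gt0_muley ?lte_fin.
Qed.

(** On [[1, 2]], [0 <= ln t <= 2] and [t <= 2], so the integrand [expR ((s - 1) * ln t - t)] is at
    least the constant [c > 0]. *)
Lemma eGamma_gt0 s : (0 < eGamma s)%E.
Proof.
pose c : R := expR (- (`|s - 1| * 2) - 2).
have c0 : 0 < c by exact: expR_gt0.
apply: (@lt_le_trans _ _ (\int[mu]_(t in `[1%R, 2%R]) c%:E)%E).
  rewrite integral_cst//= lebesgue_measure_itv/= lte_fin ltr1n -EFinB -EFinM.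
  by rewrite lte_fin mulr_gt0// subr_gt0 ltr1n.
apply: (@le_trans _ _ (\int[mu]_(t in `[1%R, 2%R]) (gamma_integrand s t)%:E)%E).
  apply: ge0_le_integral => //=.
  - by move=> t _; rewrite lee_fin ltW.
  - by apply/measurable_EFinP; exact: measurable_gamma_integrand.
  - move=> t; rewrite in_itv/= => /andP[t1 t2].
    have t0 : 0 < t by rewrite (lt_le_trans ltr01).
    rewrite lee_fin /gamma_integrand /powR gt_eqF// -expRD ler_expR.
    have ln0 : 0 <= ln t by rewrite ln_ge0.
    have ln2 : ln t <= 2 by rewrite (le_trans _ t2)// ltW// ln_sublinear.
    have : - (`|s - 1| * 2) <= (s - 1) * ln t.
      rewrite lerNl (le_trans (ler_norm _))// normrN normrM (ger0_norm ln0).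
      by rewrite ler_wpM2l.
    lra.
apply: ge0_subset_integral => //=.
- by apply/measurable_EFinP; exact: measurable_gamma_integrand.
- by move=> t _; rewrite lee_fin gamma_integrand_ge0.
- move=> t /=; rewrite !in_itv/= andbT => /andP[t1 _].
  by rewrite (lt_le_trans ltr01).
Qed.

(** [Gamma] is the [fine] part of [eGamma], which would be 0 for an infinite integral; finiteness
    excludes this. *)
Lemma GammaE s : 0 < s -> (Gamma s)%:E = eGamma s.
Proof.
by move=> s0; rewrite [LHS]fineK// ge0_fin_numE ?eGamma_ge0 ?eGamma_lty.
Qed.

Lemma Gamma_gt0 s : 0 < s -> 0 < Gamma s.
Proof. by move=> s0; rewrite -lte_fin GammaE// eGamma_gt0. Qed.

Lemma GammaS s : 0 < s -> Gamma (s + 1) = s * Gamma s.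
Proof.
move=> s0; apply: EFin_inj; rewrite GammaE ?addr_gt0// eGammaS//.
by rewrite -GammaE.
Qed.

Lemma Gamma_nat_add s n : 0 < s ->
  Gamma (n%:R + s) = Gamma s * \prod_(0 <= k < n) (s + k%:R).
Proof.
move=> s0; elim: n => [|n IH]; first by rewrite big_nil mulr1 add0r.
have ns0 : 0 < n%:R + s by rewrite ltr_wpDl.
rewrite big_nat_recr//= -natr1 addrAC GammaS// IH; ring.
Qed.

End Gamma.

(** * The Dunkl kernel as a series *)

Section Series.
Context {R : realType}.
Implicit Types (a t nu : R) (n : nat).

(** Reciprocal of the rising factorial, the [p_n(a)] of the overview; as a product of inverses it
    lends itself to a factorwise log-convexity argument. *)
Definition inv_rising a n : R := \prod_(0 <= k < n) (a + k%:R)^-1.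

Lemma inv_risingS a n : inv_rising a n.+1 = inv_rising a n * (a + n%:R)^-1.
Proof. by rewrite /inv_rising big_nat_recr. Qed.

Lemma inv_risingSl a n : inv_rising a n.+1 = a^-1 * inv_rising (a + 1) n.
Proof.
rewrite /inv_rising big_nat_recl//= addr0; congr (_ * _).
by apply: eq_bigr => k _; rewrite -addrA nat1r.
Qed.

Lemma inv_rising_ge0 a n : 0 < a -> 0 <= inv_rising a n.
Proof.
by move=> a0; apply: prodr_ge0 => k _; rewrite invr_ge0 addr_ge0// ltW.
Qed.

(** Crude bound that lets an exponential series dominate the Bessel series. *)
Lemma inv_rising_le a n : 0 < a -> inv_rising a n <= a^-1 ^+ n.
Proof.
move=> a0; elim: n => [|n IH]; first by rewrite /inv_rising big_nil expr0.
rewrite inv_risingS exprSr.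
rewrite ler_pM ?inv_rising_ge0// ?invr_ge0 ?addr_ge0 ?(ltW a0)//.
by rewrite lef_pV2 ?posrE ?lerDl// ltr_wpDr.
Qed.

Lemma Gamma_ratio a n : 0 < a -> Gamma a / Gamma (n%:R + a) = inv_rising a n.
Proof.
move=> a0; rewrite Gamma_nat_add// invfM mulrA divff.
  by rewrite mul1r /inv_rising prodfV.
by rewrite gt_eqF ?Gamma_gt0.
Qed.

(** Here [a] is the Bessel order plus one, and the prefactor [Gamma a] is absorbed into the
    coefficient. *)
Definition bessel_coeff a t n : R :=
  (t / 2) ^+ (2 * n) / n`!%:R * inv_rising a n.

Lemma bessel_coeff_ge0 a t n : 0 < a -> 0 <= bessel_coeff a t n.
Proof.
move=> a0; rewrite mulr_ge0 ?inv_rising_ge0// mulr_ge0 ?invr_ge0//.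
by rewrite exprM exprn_ge0 ?sqr_ge0.
Qed.

(** Comparison with the exponential series at [(t / 2)^2 / a]. *)
Lemma is_cvg_bessel_series a t : 0 < a -> cvgn (series (bessel_coeff a t)).
Proof.
move=> a0; apply: (@series_le_cvg _ _ (exp_coeff ((t / 2) ^+ 2 / a))).
- by move=> n; exact: bessel_coeff_ge0.
- move=> n; rewrite /exp_coeff/=.
  by rewrite divr_ge0// exprn_ge0// divr_ge0 ?sqr_ge0 ?ltW.
- move=> n; rewrite /bessel_coeff /exp_coeff/= mulrAC exprM.
  rewrite ler_wpM2r ?invr_ge0// [leRHS]exprMn ler_wpM2l ?inv_rising_le//.
  by rewrite exprn_ge0 ?sqr_ge0.
- exact: is_cvg_series_exp_coeff.
Qed.

Lemma besselj_imagE a t : 0 < a + 1 ->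
  besselj a ('i%C * t%:C)%C = ((limn (series (bessel_coeff (a + 1) t)))%:C)%C.
Proof.
move=> a0; rewrite besselj_imag; congr (_%:C)%C.
have G0 : Gamma (a + 1) != 0 by rewrite gt_eqF// Gamma_gt0.
rewrite [X in series X](_ : _ = (Gamma (a + 1))^-1 *: bessel_coeff (a + 1) t).
  by rewrite lim_seriesZ; [exact: mulVKf|exact: is_cvg_bessel_series].
apply/funext => n; rewrite /GRing.scale/= /bessel_coeff -Gamma_ratio// addrA.
have Gn0 : Gamma (n%:R + a + 1) != 0.
  by rewrite gt_eqF// Gamma_gt0// -addrA ltr_wpDl.
have f0 : n`!%:R != 0 :> R by rewrite pnatr_eq0 -lt0n fact_gt0.
by rewrite -[RHS]/(_ * _); field; rewrite Gn0 f0.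
Qed.

Definition dunkl_coeff nu t n : R :=
  bessel_coeff (nu + 2^-1) t n +
  t / (2 * nu + 1) * bessel_coeff (nu + 2^-1 + 1) t n.

Lemma cvg_dunkl_series nu lambda x : 0 < nu ->
  series (dunkl_coeff nu (lambda * x)) @ \oo --> dunkl_kernel nu lambda x.
Proof.
move=> nu0; set t := lambda * x.
have a0 : 0 < nu + 2^-1 by rewrite addr_gt0.
have a1 : 0 < nu + 2^-1 + 1 by rewrite addr_gt0.
rewrite /dunkl_kernel /dunkl_kernelC.
have e : nu - 2^-1 + 1 = nu + 2^-1 by field.
rewrite !besselj_imagE ?e// -rmorphM -rmorphD/=.
rewrite (_ : series _ = fun N => series (bessel_coeff (nu + 2^-1) t) N +
    t / (2 * nu + 1) * series (bessel_coeff (nu + 2^-1 + 1) t) N).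
  apply: cvgD; first exact: is_cvg_bessel_series.
  by apply: cvgM; [exact: cvg_cst|exact: is_cvg_bessel_series].
by apply/funext => N; rewrite /series/= big_split/= mulr_sumr.
Qed.

(** With [a = nu + 1/2], [t / (2 * nu + 1) = (t / 2) * a^-1], and this [a^-1] is the missing first
    factor that turns [p_n(a + 1)] into [p_(n+1)(a)]. *)
Lemma dunkl_coeffE nu t n : 0 < nu -> dunkl_coeff nu t n =
  (t / 2) ^+ (2 * n) / n`!%:R *
    (inv_rising (nu + 2^-1) n + t / 2 * inv_rising (nu + 2^-1) n.+1).
Proof.
move=> nu0; rewrite /dunkl_coeff /bessel_coeff inv_risingSl.
have -> : t / (2 * nu + 1) = t / 2 * (nu + 2^-1)^-1.
  by field; rewrite gt_eqF//=; lra.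
ring.
Qed.

End Series.

(** * Log-convexity *)

Section LogConvex.
Context {R : realType} (alpha : R).
Context (alpha_gt0 : 0 < alpha) (alpha_lt1 : alpha < 1).
Implicit Types f g x y : R.

(* With [f], [f1], [f2] the values of a nonnegative function at
   [alpha * nu1 + (1 - alpha) * nu2], [nu1] and [nu2], this is its log-convexity
   inequality. *)
Definition geom_bounded f f1 f2 :=
  [/\ 0 <= f, 0 <= f1, 0 <= f2 & f <= f1 `^ alpha * f2 `^ (1 - alpha)].

Let beta_gt0 : 0 < 1 - alpha. Proof. by rewrite subr_gt0. Qed.

Let ialpha : 0 < alpha^-1. Proof. by rewrite invr_gt0. Qed.

Let ibeta : 0 < (1 - alpha)^-1. Proof. by rewrite invr_gt0. Qed.

Let powK x (r : R) : 0 < r -> 0 <= x -> (x `^ r) `^ r^-1 = x.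
Proof. by move=> r0 x0; rewrite -powRrM divff ?gt_eqF// powRr1. Qed.

Let conj : alpha^-1^-1 + (1 - alpha)^-1^-1 = 1.
Proof. by rewrite !invrK addrC subrK. Qed.

Lemma geom_bounded_cst f : 0 <= f -> geom_bounded f f f.
Proof.
move=> f0; split=> //; rewrite -powRD addrC subrK ?powRr1//.
by rewrite oner_eq0.
Qed.

Lemma geom_boundedM f f1 f2 g g1 g2 :
  geom_bounded f f1 f2 -> geom_bounded g g1 g2 ->
  geom_bounded (f * g) (f1 * g1) (f2 * g2).
Proof.
move=> [f0 f10 f20 ff] [g0 g10 g20 gg]; split; rewrite ?mulr_ge0//.
by rewrite !powRM// mulrACA ler_pM.
Qed.

(** Two-term Hoelder inequality with conjugate exponents [1 / alpha] and [1 / (1 - alpha)], applied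
    to the powers [f1^alpha], [g1^alpha] and [f2^(1 - alpha)], [g2^(1 - alpha)]. *)
Lemma geom_boundedD f f1 f2 g g1 g2 :
  geom_bounded f f1 f2 -> geom_bounded g g1 g2 ->
  geom_bounded (f + g) (f1 + g1) (f2 + g2).
Proof.
move=> [f0 f10 f20 ff] [g0 g10 g20 gg]; split; rewrite ?addr_ge0//.
apply: (le_trans (lerD ff gg)).
have /= := hoelder2 (powR_ge0 f1 alpha) (powR_ge0 g1 alpha)
  (powR_ge0 f2 (1 - alpha)) (powR_ge0 g2 (1 - alpha)) ialpha ibeta conj.
by rewrite !powK// !invrK.
Qed.

(** Inverse of Young's inequality [x^alpha * y^(1 - alpha) <= alpha * x + (1 - alpha) * y]. *)
Lemma geom_bounded_inv x y : 0 < x -> 0 < y ->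
  geom_bounded (alpha * x + (1 - alpha) * y)^-1 x^-1 y^-1.
Proof.
move=> x0 y0; have s0 : 0 < alpha * x + (1 - alpha) * y.
  by rewrite addr_gt0 ?mulr_gt0.
split; rewrite ?invr_ge0 ?(ltW s0) ?(ltW x0) ?(ltW y0)//.
have powV (z r : R) : 0 < z -> z^-1 `^ r = (z `^ r)^-1.
  by move=> z0; rewrite -powR_inv1 ?(ltW z0)// -powRrM mulN1r powRN.
rewrite !powV// -invfM lef_pV2 ?posrE ?mulr_gt0 ?powR_gt0//.
have /= := conjugate_powR (powR_ge0 x alpha) (powR_ge0 y (1 - alpha))
  ialpha ibeta conj.
by rewrite !powK ?(ltW x0) ?(ltW y0)// !invrK [x * _]mulrC [y * _]mulrC.
Qed.

Lemma geom_bounded_inv_rising a b n : 0 < a -> 0 < b ->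
  geom_bounded (inv_rising (alpha * a + (1 - alpha) * b) n)
    (inv_rising a n) (inv_rising b n).
Proof.
move=> a0 b0; elim: n => [|n IH].
  by rewrite /inv_rising !big_nil; exact: geom_bounded_cst.
rewrite !inv_risingS; apply: geom_boundedM => //.
(* The weights sum to 1, so the shift by [n] distributes over the convex combination. *)
have -> : alpha * a + (1 - alpha) * b + n%:R =
  alpha * (a + n%:R) + (1 - alpha) * (b + n%:R) by ring.
by apply: geom_bounded_inv; rewrite ltr_wpDr.
Qed.

(** In the merged form of the coefficient only [p_n] and [p_(n+1)] depend on [nu]; the other factors
    are constants, nonnegative because [0 <= t]. *)
Lemma geom_bounded_dunkl_coeff t nu1 nu2 n : 0 <= t -> 0 < nu1 -> 0 < nu2 ->
  geom_bounded (dunkl_coeff (alpha * nu1 + (1 - alpha) * nu2) t n)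
    (dunkl_coeff nu1 t n) (dunkl_coeff nu2 t n).
Proof.
move=> t0 nu1_gt0 nu2_gt0.
rewrite !dunkl_coeffE ?addr_gt0 ?mulr_gt0//.
have -> : alpha * nu1 + (1 - alpha) * nu2 + 2^-1 =
  alpha * (nu1 + 2^-1) + (1 - alpha) * (nu2 + 2^-1) by ring.
apply: geom_boundedM.
  by apply: geom_bounded_cst; rewrite divr_ge0// exprn_ge0// divr_ge0.
apply: geom_boundedD; first by apply: geom_bounded_inv_rising; rewrite addr_gt0.
apply: geom_boundedM; first by apply: geom_bounded_cst; rewrite divr_ge0.
by apply: geom_bounded_inv_rising; rewrite addr_gt0.
Qed.

Lemma geom_bounded_dunkl_series t nu1 nu2 N : 0 <= t -> 0 < nu1 -> 0 < nu2 ->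
  geom_bounded (series (dunkl_coeff (alpha * nu1 + (1 - alpha) * nu2) t) N)
    (series (dunkl_coeff nu1 t) N) (series (dunkl_coeff nu2 t) N).
Proof.
move=> t0 nu1_gt0 nu2_gt0; elim: N => [|N IH].
  by rewrite /series/= !big_nil; exact: geom_bounded_cst.
rewrite /series/= !big_nat_recr//=; apply: geom_boundedD => //.
exact: geom_bounded_dunkl_coeff.
Qed.

End LogConvex.

(** * Passage to the limit in the Dunkl series *)

Section Dunkl.
Context {R : realType}.
Implicit Types lambda x nu : R.

Lemma dunkl_coeff_ge0 nu (t : R) n : 0 <= t -> 0 < nu ->
  0 <= dunkl_coeff nu t n.
Proof.
move=> t0 nu0; rewrite addr_ge0 ?bessel_coeff_ge0 ?addr_gt0// mulr_ge0//.
  by rewrite divr_ge0// addr_ge0 ?mulr_ge0// ltW.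
by rewrite bessel_coeff_ge0 ?addr_gt0.
Qed.

Lemma dunkl_series_le nu lambda x N : 0 <= lambda -> 0 <= x -> 0 < nu ->
  series (dunkl_coeff nu (lambda * x)) N <= dunkl_kernel nu lambda x.
Proof.
move=> l0 x0 nu0; have c := @cvg_dunkl_series R _ lambda x nu0.
rewrite -(cvg_lim _ c)//; apply: nondecreasing_cvgn_le; last exact: cvgP c.
by apply: nondecreasing_series => n _ _; rewrite dunkl_coeff_ge0 ?mulr_ge0.
Qed.

Lemma dunkl_kernel_ge0 nu lambda x : 0 <= lambda -> 0 <= x -> 0 < nu ->
  0 <= dunkl_kernel nu lambda x.
Proof.
move=> l0 x0 nu0; apply: le_trans (@dunkl_series_le nu lambda x 0 l0 x0 nu0).
by rewrite /series/= big_nil.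
Qed.

(** Partial sums satisfy the inequality. Those on the right are at most the kernels, since the terms
    are nonnegative; the resulting bound is independent of [N] and passes to the limit on the
    left. *)
Lemma dunkl_kernel_logconvex nu1 nu2 (alpha : R) lambda x :
  0 <= lambda -> 0 <= x -> 0 < nu1 -> 0 < nu2 -> 0 <= alpha <= 1 ->
  dunkl_kernel (alpha * nu1 + (1 - alpha) * nu2) lambda x <=
  dunkl_kernel nu1 lambda x `^ alpha * dunkl_kernel nu2 lambda x `^ (1 - alpha).
Proof.
move=> l0 x0 nu1_gt0 nu2_gt0 /andP[].
(* The endpoints 0 and 1 are treated apart, as the Hoelder exponents require [0 < alpha < 1]. There
   the power with exponent 0 is 1 for any base. *)
rewrite le_eqVlt => /predU1P[<- _|a0].
  have -> : 0 * nu1 + (1 - 0) * nu2 = nu2 by ring.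
  have := dunkl_kernel_ge0 l0 x0 nu2_gt0.
  by move: (dunkl_kernel _ _ _) => E ?; rewrite subr0 powRr0 powRr1// mul1r.
rewrite le_eqVlt => /predU1P[->|a1].
  have -> : 1 * nu1 + (1 - 1) * nu2 = nu1 by ring.
  have := dunkl_kernel_ge0 l0 x0 nu1_gt0.
  by move: (dunkl_kernel _ _ _) => E ?; rewrite subrr powRr0 powRr1// mulr1.
have b0 : 0 < 1 - alpha by rewrite subr_gt0.
have nu0 : 0 < alpha * nu1 + (1 - alpha) * nu2 by rewrite addr_gt0 ?mulr_gt0.
have c := @cvg_dunkl_series R _ lambda x nu0.
rewrite -(cvg_lim _ c)//; apply: limr_le; first exact: cvgP c.
apply: nearW => N.
have [_ s1 s2 h] :=
  @geom_bounded_dunkl_series _ _ a0 a1 _ _ _ N (mulr_ge0 l0 x0) nu1_gt0 nu2_gt0.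
apply: (le_trans h); rewrite ler_pM ?powR_ge0//.
  by rewrite ge0_ler_powR ?nnegrE ?dunkl_kernel_ge0 ?dunkl_series_le// ltW.
by rewrite ge0_ler_powR ?nnegrE ?dunkl_kernel_ge0 ?dunkl_series_le// ltW.
Qed.

End Dunkl.

Theorem theorem1 (R : realType) (lambda x : R)
    (lambda_ge0 : 0 <= lambda) (x_ge0 : 0 <= x) :
  (forall nu1 nu2 alpha : R, 0 < nu1 -> 0 < nu2 -> 0 <= alpha <= 1 ->
     dunkl_kernel (alpha * nu1 + (1 - alpha) * nu2) lambda x
       <= dunkl_kernel nu1 lambda x `^ alpha
          * dunkl_kernel nu2 lambda x `^ (1 - alpha)) /\
  (forall nu : R, 0 < nu ->
     dunkl_kernel (nu + 1) lambda x ^+ 2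
       <= dunkl_kernel nu lambda x * dunkl_kernel (nu + 2) lambda x).
Proof.
split=> [nu1 nu2 alpha|nu nu0]; first exact: dunkl_kernel_logconvex.
have nu2 : 0 < nu + 2 by rewrite addr_gt0.
have half : 0 <= (2^-1 : R) <= 1 by lra.
have nu1 : 0 < nu + 1 by rewrite addr_gt0.
have := dunkl_kernel_logconvex lambda_ge0 x_ge0 nu0 nu2 half.
have -> : 2^-1 * nu + (1 - 2^-1) * (nu + 2) = nu + 1 by field.
have -> : 1 - 2^-1 = 2^-1 :> R by field.
have := dunkl_kernel_ge0 lambda_ge0 x_ge0 nu2.
have := dunkl_kernel_ge0 lambda_ge0 x_ge0 nu1.
have := dunkl_kernel_ge0 lambda_ge0 x_ge0 nu0.
(* Abstracting the kernels keeps [rewrite] from unfolding them when it compares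
   their arguments. *)
move: (dunkl_kernel nu _ _) (dunkl_kernel (nu + 1) _ _)
  (dunkl_kernel (nu + 2) _ _) => E0 E1 E2 E0_ge0 E1_ge0 E2_ge0.
(* Powers with exponent [1/2] are square roots, so the midpoint inequality reads
   [E1 <= sqrt (E0 * E2)], to be squared. *)
rewrite !powR12_sqrt// -sqrtrM// => h.
by rewrite -[leRHS]sqr_sqrtr ?mulr_ge0// ler_sqr ?nnegrE ?sqrtr_ge0.
Qed.
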